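(* Let $\mathcal{K}$ be a local field. For $n \in \mathbb{N}$ and $k \in [n]$, let $\sigma_{n,k}$ be the push-forward of $\sigma_n$ by the map that sends $(x_i)_{i \in [n]} \in \mathcal{K}^n$ to $(x_i)_{i \in [k]} \in \mathcal{K}^k$. Then the total variation distance between the probability measures $\sigma_{n,k}$ and $\gamma_k$ is \[ \frac{q^{-n}(1-q^{-k})}{1-q^{-n}}. \]
   Context: $\mathbb{N} = \{1,2,\dots\}$ and $[n] = \{1,\dots,n\}$. A local field $\mathcal{K}$ is a locally compact, non-discrete topological field other than $\mathbb{R}$ or $\mathbb{C}$ (equivalently, for some prime $p$, a finite algebraic extension of the field of $p$-adic numbers or of the field of Laurent series over the finite field with $p$ elements). It carries its normalized non-Archimedean valuation $|\cdot|$, which satisfies $|x| = 0 \iff x = 0$, $|xy| = |x||y|$, $|x+y| \le |x| \vee |y|$, induces the topology of $\mathcal{K}$, and takes exactly the values $\{0\} \cup \{q^m : m \in \mathbb{Z}\}$, where $q = p^c$ for some prime $p$ and positive integer $c$. Let $\mathcal{D} = \{x \in \mathcal{K} : |x| \le 1\}$ be the ring of integers and fix $\rho \in \mathcal{K}$ with $|\rho| = q^{-1}$; the valuation is normalized so that $\mathcal{D}/\rho\mathcal{D}$ has $q$ elements. $\mathcal{K}^n$ has the norm $\|x\| = \bigvee_{i \in [n]} |x_i|$, and $\mathcal{S}^{(n)} = \{x \in \mathcal{K}^n : \|x\| = 1\} = \mathcal{D}^n \setminus (\rho\mathcal{D})^n$ is the unit sphere. $\lambda$ is the additive Haar measure on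 $\mathcal{K}$ normalized by $\lambda(\mathcal{D}) = 1$; $\gamma$ is the restriction of $\lambda$ to $\mathcal{D}$ (a probability measure, regarded as a measure on $\mathcal{K}$), and $\gamma_n = \gamma^{\otimes n}$. $\sigma_n$ is the probability measure $\gamma_n$ conditioned on $\mathcal{S}^{(n)}$, that is, $\sigma_n(\cdot) = \gamma_n(\cdot \cap \mathcal{S}^{(n)})/\gamma_n(\mathcal{S}^{(n)})$. The total variation distance between probability measures $\mu,\nu$ on the same space is $\sup_A |\mu(A) - \nu(A)|$ over measurable sets $A$ (for measures on a countable set, $\frac12\sum_y |\mu\{y\}-\nu\{y\}|$). *)

(* Defs.v *)
From HB Require Import structures.
From mathcomp Require Import all_boot all_order all_algebra.
From mathcomp Require Import all_classical all_reals all_analysis.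
From mathcomp Require Import complex.

Set Implicit Arguments.
Unset Strict Implicit.
Unset Printing Implicit Defensive.

Import Order.TTheory GRing.Theory Num.Theory.
Import numFieldNormedType.Exports.

Local Open Scope classical_set_scope.
Local Open Scope ring_scope.

HB.mixin Record isTopologicalField K & GRing.Field K & Topological K := {
  topfield_mul_continuous : continuous (fun x : K * K => x.1 * x.2);
  topfield_inv_continuous :
    forall x : K, x != 0 -> {for x, continuous (@GRing.inv K)} }.

#[short(type="topologicalFieldType")]
HB.structure Definition TopologicalField :=
  {K of GRing.Field K & TopologicalZmodule K & isTopologicalField K}.

(* The library requires a pointed type for generating a sigma-algebra. *)
HB.instance Definition _ (K : topologicalFieldType) :=
  isPointed.Build (TopologicalField.sort K) 0.

Definition topological_field_iso (K : topologicalFieldType)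
    (F : numFieldType) : Prop :=
  exists (f : {rmorphism K -> F}) (g : F -> K),
    [/\ cancel f g, cancel g f, continuous f & continuous g].

Record local_field (R : realType) (K : topologicalFieldType) : Prop := {
  local_field_hausdorff : hausdorff_space K;
  local_field_locally_compact : locally_compact [set: K];
  local_field_nondiscrete : ~ (forall A : set K, open A);
  local_field_not_real : ~ topological_field_iso K R;
  local_field_not_complex : ~ topological_field_iso K R[i] }.

Section valuation.
Variables (R : realType) (K : topologicalFieldType).

Definition closed_unit_ball (absv : K -> R) : set K := [set x | absv x <= 1].

Record normalized_valuation := {
  absv :> K -> R;
  resq : nat;
  resq_prime_power :
    exists p c : nat, [/\ prime p, (0 < c)%N & resq = (p ^ c)%N];
  absv_eq0 : forall x, absv x = 0 <-> x = 0;
  absvM : forall x y, absv (x * y) = absv x * absv y;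
  absvD : forall x y, absv (x + y) <= Num.max (absv x) (absv y);
  absv_nbhs : forall (x : K) (A : set K),
    nbhs x A <-> exists2 e : R, 0 < e & [set y | absv (y - x) < e] `<=` A;
  absv_range :
    range absv = [set 0] `|` range (fun m : int => (resq%:R : R) ^ m);
  uniformizer : K;
  absv_uniformizer : absv uniformizer = (resq%:R)^-1;
  (* D / rho D, as the set of cosets x + rho D with x in D *)
  residue_card :
    ([set [set x + uniformizer * y | y in closed_unit_ball absv]
      | x in closed_unit_ball absv] #= `I_resq)%card }.

End valuation.

(* K with its Borel sigma-algebra. The measurable structure on n.-tuple (borel K)
   is the n-fold product one, which is again the Borel one because a local field
   is second countable. *)
Notation borel K := (g_sigma_algebraType (@open K)).

Section valuation_theory.
Variables (R : realType) (K : topologicalFieldType).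
Variable v : normalized_valuation R K.

Definition integers : set (borel K) := closed_unit_ball v.

Lemma absv_ge0 x : 0 <= v x.
Proof.
have : range v (v x) by exists x.
rewrite absv_range => -[->//|[m _ <-]].
by rewrite exprz_ge0.
Qed.

Lemma absv1 : v 1 = 1.
Proof.
have /eqP : v 1 * v 1 = v 1 * 1 by rewrite -absvM !mulr1.
have v10 : v 1 != 0 by apply/eqP => /absv_eq0/eqP; rewrite oner_eq0.
by move=> /eqP /(mulfI v10).
Qed.

Lemma absvN x : v (- x) = v x.
Proof.
suff vN1 : v (-1) = 1 by rewrite -mulN1r absvM vN1 mul1r.
have /eqP : v (-1) ^+ 2 = 1 by rewrite expr2 -absvM mulrNN mulr1 absv1.
rewrite sqrf_eq1 => /orP[/eqP//|/eqP h].
by have := absv_ge0 (-1); rewrite h ler0N1.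
Qed.

Lemma absv_ball_open (x : K) (r : R) : open [set y | v (y - x) < r].
Proof.
rewrite openE => y /= yr; apply/(absv_nbhs v); exists r.
  exact: le_lt_trans (absv_ge0 _) yr.
move=> z /= zr; have -> : z - x = (z - y) + (y - x) by rewrite addrA subrK.
by apply: le_lt_trans (absvD _ _ _) _; rewrite gt_max zr yr.
Qed.

Lemma integers_open : open (closed_unit_ball v).
Proof.
rewrite openE => y /= y1; apply/(absv_nbhs v); exists 1 => // z /= z1.
have -> : z = (z - y) + y by rewrite subrK.
by apply: le_trans (absvD _ _ _) _; rewrite ge_max (ltW z1) y1.
Qed.

Lemma measurable_integers : measurable integers.
Proof. by apply: sub_sigma_algebra; exact: integers_open. Qed.

Definition max_ideal : set (borel K) := [set x | v x < 1].

Lemma measurable_max_ideal : measurable max_ideal.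
Proof.
apply: sub_sigma_algebra.
by have := absv_ball_open 0 1; under eq_set do rewrite subr0.
Qed.

End valuation_theory.

Record haar_measure (R : realType) (K : topologicalFieldType)
    (mu : {measure set (borel K) -> \bar R}) : Prop := {
  haar_translation : forall (x : K) (A : set (borel K)),
    measurable A -> mu [set x + y | y in A] = mu A;
  haar_compact : forall C : set K, compact C -> (mu C < +oo)%E;
  haar_outer_regular : forall A : set (borel K), measurable A ->
    mu A = ereal_inf [set mu U | U in [set U : set K | open U /\ A `<=` U]];
  haar_inner_regular : forall U : set K, open U ->
    mu U = ereal_sup [set mu C | C in [set C : set K | compact C /\ C `<=` U]];
  haar_neq0 : mu [set: borel K] <> 0%E }.

Record normalized_haar (R : realType) (K : topologicalFieldType)
    (v : normalized_valuation R K) := {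
  haar_lambda :> {measure set (borel K) -> \bar R};
  haar_lambdaP : haar_measure haar_lambda;
  haar_lambda_integers : haar_lambda (integers v) = 1%E }.

Section power_probability.
Context d (T : measurableType d) (R : realType).

Definition tcons n (x : T * n.-tuple T) : n.+1.-tuple T :=
  [tuple of x.1 :: x.2].

Lemma measurable_tcons n : measurable_fun setT (@tcons n).
Proof. exact: measurable_cons. Qed.

HB.instance Definition _ n :=
  isMeasurableFun.Build _ _ _ _ (@tcons n) (@measurable_tcons n).

Fixpoint power_probability (P : probability T R) (n : nat) :
    probability (n.-tuple T) R :=
  match n with
  | 0 => dirac [tuple]
  | m.+1 => distribution (P \x power_probability P m)%E (@tcons m)
  end.

Definition tprefix n k (kn : (k <= n)%N) (x : n.-tuple T) : k.-tuple T :=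
  [tuple tnth x (widen_ord kn i) | i < k].

Lemma measurable_tprefix n k (kn : (k <= n)%N) :
  measurable_fun setT (tprefix kn).
Proof.
apply/measurable_fun_tnthP => i.
rewrite (_ : _ \o _ = (@tnth _ T)^~ (widen_ord kn i)).
  exact: measurable_tnth.
by apply/funext => x /=; rewrite tnth_mktuple.
Qed.

HB.instance Definition _ n k (kn : (k <= n)%N) :=
  isMeasurableFun.Build _ _ _ _ (tprefix kn) (measurable_tprefix kn).

Definition tv_dist (P Q : probability T R) : \bar R :=
  ereal_sup [set `|P A - Q A|%E | A in measurable].

Lemma measurable_box n (A : 'I_n -> set T) : (forall i, measurable (A i)) ->
  measurable [set x : n.-tuple T | forall i, A i (tnth x i)].
Proof.
move=> mA.
rewrite (_ : mkset _ =
    \bigcap_(i in [set: 'I_n]) ((@tnth _ T)^~ i @^-1` A i)).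
  apply: fin_bigcap_measurable => [|i _]; first exact: finite_finset.
  by rewrite -[X in measurable X]setTI; exact: measurable_tnth.
by apply/seteqP; split=> [x h i _|x h i]; [exact: h|exact: (h i)].
Qed.

Lemma power_probability_box (P : probability T R) n (A : 'I_n -> set T) :
  (forall i, measurable (A i)) ->
  power_probability P n [set x | forall i, A i (tnth x i)] =
  (\prod_(i < n) P (A i))%E.
Proof.
elim: n A => [|n IH] A mA /=.
  by rewrite big_ord0 diracE mem_set//= => -[].
rewrite big_ord_recl -IH => [|i]; last exact: mA.
rewrite /distribution /pushforward -product_measure1E//; last first.
  by apply: (measurable_box (A := fun i => A (lift ord0 i))) => i; exact: mA.
congr (_ _); apply/seteqP; split => -[x t] /=.
  move=> h; split; first exact: (h ord0).
  by move=> i; have := h (lift ord0 i); rewrite tnthS.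
move=> [h0 h] i; case: (unliftP ord0 i) => [j ->|->]//.
by rewrite tnthS; exact: h.
Qed.

End power_probability.

Section sphere.
Variables (R : realType) (K : topologicalFieldType).
Variables (v : normalized_valuation R K) (lambda : normalized_haar v).

Definition gamma : set (borel K) -> \bar R :=
  mrestr lambda (measurable_integers v).

HB.instance Definition _ := Measure.on gamma.

Lemma gamma_setT : gamma setT = 1%E.
Proof. by rewrite /gamma /mrestr setTI haar_lambda_integers. Qed.

HB.instance Definition _ := Measure_isProbability.Build _ _ _ gamma gamma_setT.

Definition gamma_pow (n : nat) : probability (n.-tuple (borel K)) R :=
  power_probability gamma n.

Definition tnorm n (x : n.-tuple (borel K)) : R :=
  \big[Num.max/0]_(i < n) v (tnth x i).

Definition sphere n : set (n.-tuple (borel K)) := [set x | tnorm x = 1].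

Arguments sphere : clear implicits.

Lemma sphereE n : sphere n =
  [set x | forall i, integers v (tnth x i)] `\`
  [set x | forall i, max_ideal v (tnth x i)].
Proof.
apply/seteqP; split => x /=; rewrite /sphere /tnorm /=.
  move=> x1; split=> [i|h].
    by rewrite /integers /closed_unit_ball /= -x1; exact: le_bigmax.
  suff : tnorm x < 1 by rewrite /tnorm x1 ltxx.
  by apply: bigmax_lt => // i _; exact: h.
move=> [h1 h2]; apply/eqP; rewrite eq_le; apply/andP; split.
  by apply: bigmax_le => // i _; exact: h1.
rewrite leNgt; apply/negP => h; apply: h2 => i.
by apply: le_lt_trans h; exact: le_bigmax.
Qed.

Lemma measurable_sphere n : measurable (sphere n).
Proof.
rewrite sphereE; apply: measurableD.
  by apply: (measurable_box (A := fun=> integers v)) => _;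
    exact: measurable_integers.
by apply: (measurable_box (A := fun=> max_ideal v)) => _;
  exact: measurable_max_ideal.
Qed.

(* gamma_n conditioned on the unit sphere. The last argument of mnormalize is
   the default for a negligible conditioning event, which by sphere_gt0 only
   occurs for n = 0; see sigmaE for the explicit formula. *)
Definition sigma (n : nat) : probability (n.-tuple (borel K)) R :=
  mnormalize (mrestr (gamma_pow n) (@measurable_sphere n)) (gamma_pow n).

Lemma gamma_lt1 : (gamma (max_ideal v) < 1)%E.
Proof.
rewrite lt_neqAle (probability_le1 gamma) ?andbT; last exact: measurable_max_ideal.
apply/eqP => g1.
pose m := max_ideal v.
have mm : measurable m := measurable_max_ideal v.
have mD : m `<=` integers v by move=> x; exact: ltW.
have lm : lambda m = 1%E by move: g1; rewrite /gamma /mrestr setIidl.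
pose u : set (borel K) := [set 1 + y | y in m].
have lu : lambda u = 1%E.
  by rewrite /u (haar_translation (haar_lambdaP lambda)).
have uE : u = [set x | v (x - 1) < 1].
  apply/seteqP; split=> [_ [y my <-]|x /= x1] /=.
    by rewrite addrC addrA addNr add0r.
  by exists (x - 1) => //; rewrite addrC subrK.
have mu : measurable u.
  by rewrite uE; apply: sub_sigma_algebra; exact: absv_ball_open.
have mu0 : m `&` u = set0.
  apply/seteqP; split=> // x [/= x1]; rewrite uE /= => x2.
  have : v 1 < 1.
    have -> : (1 : K) = x - (x - 1) by rewrite opprB addrCA subrr addr0.
    by apply: le_lt_trans (absvD _ _ _) _; rewrite absvN gt_max x1 x2.
  by rewrite absv1 ltxx.
have uD : u `<=` integers v.
  move=> _ [y my <-]; apply: le_trans (absvD _ _ _) _.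
  by rewrite ge_max absv1 lexx/= ltW.
have : (lambda (m `|` u) <= lambda (integers v))%E.
  apply: le_measure; rewrite ?inE//.
  - exact: measurableU.
  - exact: measurable_integers.
  - by rewrite subUset.
have -> : lambda (m `|` u) = (1 + 1)%E.
  by rewrite measureU//; congr (_ + _)%E; [exact: lm|exact: lu].
rewrite haar_lambda_integers -EFinD lee_fin.
by rewrite gerDl ler10.
Qed.

Lemma sphere_gt0 n : (0 < n)%N -> (0 < gamma_pow n (sphere n))%E.
Proof.
case: n => // n _; rewrite sphereE.
set I := [set x | _]; set J := [set x | _].
have mI : measurable I by apply: (measurable_box (A := fun=> integers v)) => _;
    exact: measurable_integers.
have mJ : measurable J.
  by apply: (measurable_box (A := fun=> max_ideal v)) => _;
    exact: measurable_max_ideal.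
have JI : J `<=` I by move=> x h i; exact: ltW (h i).
have gI : gamma_pow n.+1 I = 1%E.
  rewrite /gamma_pow
    (power_probability_box _ (A := fun=> integers v)); last first.
    by move=> _; exact: measurable_integers.
  by rewrite big1// => i _; rewrite /= /gamma /mrestr setIid haar_lambda_integers.
have gJ : (gamma_pow n.+1 J < 1)%E.
  rewrite /gamma_pow
    (power_probability_box _ (A := fun=> max_ideal v)); last first.
    by move=> _; exact: measurable_max_ideal.
  rewrite big_ord_recl /=; apply: le_lt_trans gamma_lt1.
  rewrite -[leRHS]mule1; apply: lee_pmul => //.
    by apply: prode_ge0 => i _; exact: measure_ge0.
  rewrite -(power_probability_box gamma (A := fun=> max_ideal v)).
    apply: probability_le1.
    apply: (measurable_box (A := fun=> max_ideal v)) => _.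
    exact: measurable_max_ideal.
  by move=> _; exact: measurable_max_ideal.
have mIoo : (gamma_pow n.+1 I < +oo)%E by rewrite gI ltry.
have -> : gamma_pow n.+1 (I `\` J) = (1 - gamma_pow n.+1 J)%E.
  by rewrite -gI -{2}(setIidr JI); exact: measureD.
by rewrite sube_gt0.
Qed.

Lemma sigmaE n (A : set (n.-tuple (borel K))) : (0 < n)%N ->
  sigma n A = (gamma_pow n (A `&` sphere n) *
               (fine (gamma_pow n (sphere n)))^-1%:E)%E.
Proof.
move=> n0.
have E : mrestr (gamma_pow n) (@measurable_sphere n) setT =
    gamma_pow n (sphere n) by rewrite /mrestr setTI.
have Soo : (gamma_pow n (sphere n) < +oo)%E.
  by rewrite (le_lt_trans (probability_le1 _ (@measurable_sphere n))) ?ltry.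
rewrite /sigma /= /mnormalize; case: ifPn => [/orP[]/eqP h|_].
- by move: (sphere_gt0 n0); rewrite -E [X in (0 < X)%E]h ltxx.
- by move: Soo; rewrite -E [X in (X < _)%E]h ltxx.
- by congr (_ * (fine _)^-1%:E)%E; exact: E.
Qed.

End sphere.

Arguments sphere {R K} v n _.

(* Main.v *)
Require Import Defs.
From HB Require Import structures.
From mathcomp Require Import all_boot all_order all_algebra.
From mathcomp Require Import all_classical all_reals all_analysis.
From mathcomp Require Import ring lra.

Set Implicit Arguments.
Unset Strict Implicit.
Unset Printing Implicit Defensive.

Import Order.TTheory GRing.Theory Num.Theory.
Import numFieldNormedType.Exports.

Local Open Scope classical_set_scope.
Local Open Scope ring_scope.

(** Write [D] for the integers, [M] for the maximal ideal [{x | v x < 1}] and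
[gamma_n] for the n-th power of [gamma].  The unit sphere of K^n is D^n minus
M^n, so conditioning on it only removes the cube M^n.

Since D splits into q translates of M, [gamma M = 1/q], hence
[gamma_n (M^n) = q^-n] and the sphere has mass [1 - q^-n].  For a Borel set B of
K^k, the cylinder over B meets M^n in a set of mass [h q^-(n-k)], where
[h = gamma_k (B cap M^k)], because the last n - k coordinates are independent of
the first k ([power_probability_prefix]).  With [g = gamma_k B] the projected
measure of B is therefore [(g - h q^-(n-k)) / (1 - q^-n)], and
subtracting g gives the exact discrepancy ([projected_sigma_bias])

    q^-n / (1 - q^-n) * (g - h q^k).

Here [h q^k] is the conditional probability of B given M^k, so the last factor is
the difference between the probability of B and its conditional probability given
an event of probability [p = q^-k].  Such a difference is at most [1 - p] in
absolute value ([conditioning_bias_le]), and equals [-(1 - p)] when B is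
the event M^k itself, so the supremum over B is the stated value. *)

(** * Cylinders over cubes in a power of a probability space *)

Section power_of_a_set.
Context d (T : measurableType d).

Definition cube (M : set T) n : set (n.-tuple T) :=
  [set x | forall i, M (tnth x i)].

Arguments cube M n : clear implicits.

Lemma measurable_cube M n : measurable M -> measurable (cube M n).
Proof. by move=> mM; exact: (measurable_box (A := fun=> M)). Qed.

Lemma tcons_cube M n x (t : n.-tuple T) :
  cube M n.+1 (tcons (x, t)) <-> M x /\ cube M n t.
Proof.
split=> [h|[Mx Mt] i].
  by split=> [|i]; [exact: (h ord0)|have := h (lift ord0 i); rewrite tnthS].
by case: (unliftP ord0 i) => [j ->|->//]; rewrite tnthS; exact: Mt.
Qed.

Lemma tprefix_tcons n k (kn : (k.+1 <= n.+1)%N) (kn' : (k <= n)%N)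
    x (t : n.-tuple T) :
  tprefix kn (tcons (x, t)) = tcons (x, tprefix kn' t).
Proof.
apply: eq_from_tnth => i; rewrite tnth_mktuple.
case: (unliftP ord0 i) => [j ->|->]; last by rewrite /tcons !(tnth_nth x).
rewrite [RHS]tnthS tnth_mktuple.
rewrite (_ : widen_ord _ _ = lift ord0 (widen_ord kn' j)) ?tnthS//.
exact/val_inj.
Qed.

Lemma measurable_tprefix_preimage n k (kn : (k <= n)%N) (B : set (k.-tuple T)) :
  measurable B -> measurable (tprefix kn @^-1` B).
Proof.
by move=> mB; rewrite -[X in measurable X]setTI; exact: measurable_tprefix.
Qed.

Context (R : realType).

Lemma power_probability_cube (P : probability T R) M n : measurable M ->
  power_probability P n (cube M n) = (P M ^+ n)%E.
Proof.
move=> mM; rewrite (power_probability_box P (A := fun=> M))//.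
by rewrite big_const_ord iter_mule mule1.
Qed.

(** Inside a cube, a condition on the first k coordinates is independent of the
remaining n - k ones.  The induction peels off the head coordinate x: the section
at x of the cylinder is the cylinder over the section of B, cut by a cube one
dimension lower, when x lies in M, and is empty otherwise, so the factor
[P M ^+ (n - k)] comes out of the integral over x. *)
Lemma power_probability_prefix (P : probability T R) M n k (kn : (k <= n)%N)
    (B : set (k.-tuple T)) : measurable M -> measurable B ->
  power_probability P n (tprefix kn @^-1` B `&` cube M n) =
  (power_probability P k (B `&` cube M k) * P M ^+ (n - k))%E.
Proof.
move=> mM; elim: k n kn B => [|k IH] n kn B mB.
  (* [0.-tuple T] has a single point: B is empty or everything. *)
  rewrite subn0 /= diracE.
  have [B0|B0] := pselect (B [tuple]).
    rewrite mem_set ?mul1e; last by split => // -[].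
    rewrite -power_probability_cube//; congr (power_probability P n _).
    apply/seteqP; split=> [x []//|x Mx]; split=> //.
    by rewrite /= (tuple0 (tprefix _ _)).
  rewrite memNset ?mul0e; last by move=> [].
  rewrite (_ : _ `&` _ = set0) ?measure0//; apply/seteqP; split=> // x [Bx _].
  by apply: B0; move: Bx; rewrite /= (tuple0 (tprefix _ _)).
case: n kn => // n kn; have kn' : (k <= n)%N := kn.
have mBM m (A : set (m.-tuple T)) : measurable A -> measurable (A `&` cube M m).
  by move=> mA; apply: measurableI => //; exact: measurable_cube.
rewrite subSS /= /distribution /pushforward /product_measure1.
set A1 := _ @^-1` _; set A2 := _ @^-1` (B `&` _).
have mtc m (A : set (m.+1.-tuple T)) : measurable A -> measurable (@tcons _ T m @^-1` A).
  by move=> mA; rewrite -[X in measurable X]setTI; exact: measurable_tcons.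
rewrite -ge0_integralZr//; last 2 first.
- by apply: measurable_fun_xsection; apply: mtc; exact: mBM.
- by apply: expe_ge0.
apply: eq_integral => x _ /=.
have [Mx|Mx] := pselect (M x); last first.
  have -> : xsection A1 x = set0.
    by apply/seteqP; split=> // t /xsectionP[_ /tcons_cube[]].
  have -> : xsection A2 x = set0.
    by apply/seteqP; split=> // t /xsectionP[_ /tcons_cube[]].
  by rewrite !measure0 mul0e.
pose Bx := xsection (@tcons _ T k @^-1` B) x.
have mBx : measurable Bx by apply: measurable_xsection; exact: mtc.
have -> : xsection A1 x = tprefix kn' @^-1` Bx `&` cube M n.
  have A1E t : A1 (x, t) <-> B (tcons (x, tprefix kn' t)) /\ (M x /\ cube M n t).
    rewrite -tcons_cube -(tprefix_tcons kn); split; exact.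
  apply/seteqP; split=> t.
    by move=> /xsectionP/A1E[Bt [_ Mt]]; split=> //; exact/xsectionP.
  by move=> [/xsectionP Bt Mt]; apply/xsectionP/A1E.
have -> : xsection A2 x = Bx `&` cube M k.
  apply/seteqP; split=> t.
    by move=> /xsectionP[Bt /tcons_cube[_ Mt]]; split=> //; exact/xsectionP.
  by move=> [/xsectionP Bt Mt]; apply/xsectionP; split=> //; exact/tcons_cube.
exact: IH.
Qed.

End power_of_a_set.

Arguments cube {d T} M n.

(** * The maximal ideal and its measure *)

Section max_ideal.
Variables (R : realType) (K : topologicalFieldType).
Variable v : normalized_valuation R K.

Lemma resq_gt1 : 1 < (resq v)%:R :> R.
Proof.
have [p [c [pp c0 ->]]] := resq_prime_power v.
by rewrite ltr1n -(exp1n c) ltn_exp2r ?prime_gt1.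
Qed.

(** This is where discreteness of the value group enters: a value below 1 is at
most [q^-1], so dividing by the uniformizer stays in the unit ball.  It identifies
the cosets counted by [residue_card] with the open balls of radius 1. *)
Lemma max_idealE :
  max_ideal v = [set uniformizer v * y | y in closed_unit_ball v].
Proof.
have q1 := resq_gt1; set q : R := (resq v)%:R in q1.
have q0 : 0 < q by apply: lt_trans q1.
have vr : v (uniformizer v) = q^-1 := absv_uniformizer v.
have r0 : uniformizer v != 0.
  by apply/eqP => /(absv_eq0 v); rewrite vr => /eqP; rewrite invr_eq0 gt_eqF.
apply/seteqP; split=> [x /= x1|_ [y y1 <-]] /=; last first.
  rewrite /max_ideal /= absvM vr; apply: (@le_lt_trans _ _ q^-1).
    by rewrite ler_piMr// invr_ge0 ltW.
  by rewrite invf_lt1.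
exists ((uniformizer v)^-1 * x); last by rewrite mulVKf.
have vrV : v (uniformizer v)^-1 = q.
  by apply: (mulfI (invr_neq0 (lt0r_neq0 q0))); rewrite -{1}vr -absvM divff// absv1 mulVf ?gt_eqF.
rewrite /closed_unit_ball /= absvM vrV.
have : range v (v x) by exists x.
rewrite absv_range => -[->|[m _ vx]]; first by rewrite mulr0.
move: x1; rewrite /max_ideal /= -vx -/q -(expr0z q) ltr_eXz2l// => m0.
have -> : q * q ^ m = q ^ (m + 1) by rewrite expfzDr ?gt_eqF// expr1z mulrC.
by rewrite ler_eXz2l// lezD1.
Qed.

Lemma max_ideal_cosetP x y :
  [set x + z | z in max_ideal v] y <-> v (y - x) < 1.
Proof.
split=> [[z mz <-]|yx]; first by rewrite addrAC subrr add0r.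
by exists (y - x) => //; rewrite addrC subrK.
Qed.

Lemma measurable_max_ideal_coset x :
  measurable ([set x + y | y in max_ideal v] : set (borel K)).
Proof.
rewrite (_ : [set _ | _ in _] = [set y | v (y - x) < 1]).
  by apply: sub_sigma_algebra; exact: absv_ball_open.
by apply/seteqP; split=> y /max_ideal_cosetP.
Qed.

Let cosets : set (set (borel K)) :=
  [set [set x + y | y in max_ideal v] | x in closed_unit_ball v].

(** By the ultrametric inequality, any point of an open ball is a centre of it, so
two balls of radius 1 that meet coincide. *)
Lemma trivIset_max_ideal_cosets : trivIset cosets id.
Proof.
move=> _ _ [x1 _ <-] [x2 _ <-] [y [/max_ideal_cosetP h1 /max_ideal_cosetP h2]].
have h12 : v (x1 - x2) < 1.
  rewrite (_ : _ - _ = (y - x2) - (y - x1)); last by ring.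
  by apply: le_lt_trans (absvD _ _ _) _; rewrite absvN gt_max h1 h2.
apply/seteqP; split=> z /max_ideal_cosetP hz; apply/max_ideal_cosetP.
  rewrite (_ : _ - _ = (z - x1) + (x1 - x2)); last by ring.
  by apply: le_lt_trans (absvD _ _ _) _; rewrite gt_max hz h12.
rewrite (_ : _ - _ = (z - x2) - (x1 - x2)); last by ring.
by apply: le_lt_trans (absvD _ _ _) _; rewrite absvN gt_max hz h12.
Qed.

Lemma bigcup_max_ideal_cosets : \bigcup_(C in cosets) C = integers v.
Proof.
rewrite /cosets bigcup_image; apply/seteqP; split=> [y [x Dx]|x Dx]; last first.
  by exists x => //; apply/max_ideal_cosetP; rewrite subrr (absv_eq0 v 0).2.
move=> /max_ideal_cosetP yx; rewrite /integers /closed_unit_ball /=.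
rewrite -(subrK x y); apply: le_trans (absvD _ _ _) _.
by rewrite ge_max (ltW yx).
Qed.

Lemma card_max_ideal_cosets : (cosets #= `I_(resq v))%card.
Proof.
rewrite (_ : cosets = [set [set x + uniformizer v * y | y in closed_unit_ball v]
                      | x in closed_unit_ball v]); first exact: residue_card.
rewrite /cosets max_idealE; congr image; apply/funext => x.
by rewrite image_comp.
Qed.

Variable lambda : normalized_haar v.

(** The q cosets of the maximal ideal partition the integers and have the same
Haar measure by translation invariance. *)
Lemma gamma_max_ideal : gamma lambda (max_ideal v) = ((resq v)%:R^-1)%:E.
Proof.
have q0 : (resq v)%:R != 0 :> R by apply: lt0r_neq0; exact: lt_trans resq_gt1.
pose m := max_ideal v.
have mm : measurable m := measurable_max_ideal v.
have mD : m `<=` integers v by move=> x; exact: ltW.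
have -> : gamma lambda (max_ideal v) = lambda m.
  by rewrite /gamma /mrestr setIidl.
have cosets_q := card_max_ideal_cosets.
have cosets_finite : finite_set cosets by exists (resq v).
move: cosets_q; rewrite card_eq_sym => /card_set_bijP[h hb].
have := haar_lambda_integers lambda; rewrite -bigcup_max_ideal_cosets.
rewrite (measure_fin_bigcup _ (F := id))//; last 2 first.
- exact: trivIset_max_ideal_cosets.
- by move=> _ [x _ <-]; exact: measurable_max_ideal_coset.
rewrite (reindex_fsbig h _ _ _ hb) -fsbig_ord.
rewrite (eq_bigr (fun=> lambda m)); last first.
  move=> i _; have : cosets (h i) by apply: (set_bij_sub hb); exists i => /=.
  by move=> [x _ <-]; exact: (haar_translation (haar_lambdaP lambda)).
have lm : lambda m \is a fin_num.
  rewrite ge0_fin_numE//; apply: (@le_lt_trans _ _ 1%E); last exact: ltry.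
  rewrite -(haar_lambda_integers lambda); apply: le_measure => //; rewrite inE //.
  exact: measurable_integers.
rewrite -(fineK lm) sumEFin sumr_const card_ord => -[]h1; congr EFin.
by apply: (mulfI q0); rewrite divff// -[RHS]h1 mulr_natl.
Qed.

End max_ideal.

(** * The projection of the uniform measure on the sphere *)

Section projected_sphere.
Variables (R : realType) (K : topologicalFieldType).
Variables (v : normalized_valuation R K) (lambda : normalized_haar v).

Let q : R := (resq v)%:R.
Let D := integers v.
Let M := max_ideal v.

Lemma gamma_integers : gamma lambda D = 1%E.
Proof. by rewrite /gamma /mrestr setIid haar_lambda_integers. Qed.

Lemma gamma_pow_cube_max_ideal n :
  gamma_pow lambda n (cube M n) = (q ^- n)%:E.
Proof.
rewrite /gamma_pow power_probability_cube; last exact: measurable_max_ideal.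
by rewrite [X in expe X]gamma_max_ideal -EFin_expe exprVn.
Qed.

Lemma gamma_pow_setI_cube_integers n (B : set (n.-tuple (borel K))) :
  measurable B -> gamma_pow lambda n (B `&` cube D n) = gamma_pow lambda n B.
Proof.
move=> mB; have mD : measurable (cube D n).
  by apply: measurable_cube; exact: measurable_integers.
have D1 : gamma_pow lambda n (cube D n) = 1%E.
  rewrite /gamma_pow power_probability_cube; last exact: measurable_integers.
  by rewrite [X in expe X]gamma_integers -EFin_expe expr1n.
have C0 : gamma_pow lambda n (~` cube D n) = 0%E.
  by rewrite probability_setC// D1 subee.
have B0 : gamma_pow lambda n (B `\` cube D n) = 0%E.
  apply: subset_measure0 C0; first exact: measurableD.
    exact: measurableC.
  by move=> x [].
by rewrite [RHS](measureDI _ mB mD) [X in (X + _)%E]B0 add0e.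
Qed.

(** The sphere is D^n minus M^n; the first cube has full measure, and the mass of
the cylinder inside the second one factors. *)
Lemma gamma_pow_prefix_sphere n k (kn : (k <= n)%N)
    (B : set (k.-tuple (borel K))) : measurable B ->
  gamma_pow lambda n (tprefix kn @^-1` B `&` sphere v n) =
  (gamma_pow lambda k B
   - gamma_pow lambda k (B `&` cube M k) * (q ^- (n - k))%:E)%E.
Proof.
move=> mB.
have mA := measurable_tprefix_preimage kn mB.
have mM := measurable_max_ideal v; have mD := measurable_integers v.
have MD : cube M n `<=` cube D n by move=> x h i; exact: ltW (h i).
have -> : tprefix kn @^-1` B `&` sphere v n =
   (tprefix kn @^-1` B `&` cube D n) `\` (tprefix kn @^-1` B `&` cube M n).
  rewrite sphereE; apply/seteqP; split=> x /=.
    by move=> [Bx [Dx Mx]]; split=> // -[_].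
  by move=> [[Bx Dx] Mx]; do 2!split => //; move=> Mx'; apply: Mx.
rewrite measureD; last 3 first.
- by apply: measurableI => //; exact: measurable_cube.
- by apply: measurableI => //; exact: measurable_cube.
- by rewrite ltey_eq fin_num_measure//; apply: measurableI => //; exact: measurable_cube.
rewrite (setIidr (setIS MD)); congr (_ - _)%E.
  transitivity (gamma_pow lambda k (B `&` cube D k) * gamma lambda D ^+ (n - k))%E.
    exact: power_probability_prefix.
  by rewrite gamma_pow_setI_cube_integers// gamma_integers -EFin_expe expr1n mule1.
transitivity (gamma_pow lambda k (B `&` cube M k) * gamma lambda M ^+ (n - k))%E.
  exact: power_probability_prefix.
by rewrite gamma_max_ideal -EFin_expe exprVn.
Qed.

Lemma gamma_pow_sphere n : gamma_pow lambda n (sphere v n) = (1 - q ^- n)%:E.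
Proof.
have := gamma_pow_prefix_sphere (leqnn n) measurableT.
rewrite preimage_setT !setTI probability_setT gamma_pow_cube_max_ideal.
by rewrite subnn expr0 invr1 mule1.
Qed.

(** The last factor is the mass of B minus its conditional mass given M^k, whose
probability is [q^-k]. *)
Lemma projected_sigma_bias n k (kn : (k <= n)%N) (B : set (k.-tuple (borel K))) :
  (0 < n)%N -> measurable B ->
  (distribution (sigma lambda n) (tprefix kn) B - gamma_pow lambda k B)%E =
  (q ^- n / (1 - q ^- n) *
     (fine (gamma_pow lambda k B)
      - fine (gamma_pow lambda k (B `&` cube M k)) * (q ^- k)^-1))%:E.
Proof.
move=> n0 mB.
have q1 : 1 < q := resq_gt1 v; have q0 : q != 0 by rewrite gt_eqF// (lt_trans _ q1).
have qn1 : 1 - q ^- n != 0.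
  by rewrite subr_eq0 gt_eqF// invf_lt1 ?exprn_egt1 ?exprn_gt0 -?lt0n// (lt_trans _ q1).
have mBM : measurable (B `&` cube M k).
  by apply: measurableI => //; apply: measurable_cube; exact: measurable_max_ideal.
rewrite /distribution /pushforward sigmaE// gamma_pow_prefix_sphere//.
rewrite gamma_pow_sphere /=.
rewrite -[gamma_pow lambda k B]fineK ?fin_num_measure//.
rewrite -[gamma_pow lambda k (B `&` _)]fineK ?fin_num_measure//.
rewrite -!(EFinM, EFinB) /=; congr EFin.
have -> : q ^- (n - k) = q ^- n * q ^+ k.
  by rewrite -{2}(subnK kn) exprD invfM mulfVK ?expf_neq0.
by rewrite invrK; move: (q ^- n) qn1 => x qn1; field.
Qed.

End projected_sphere.

(** Conditioning on an event of probability p changes the probability g of an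
event by at most [1 - p]; h is the probability of the intersection.  With
[c = h / p <= 1], [g - c] lies between [h - c = - c (1 - p)] and
[h + (1 - p) - c]. *)
Lemma conditioning_bias_le (R : realFieldType) (p g h : R) :
  0 < p <= 1 -> 0 <= h -> h <= g -> h <= p -> g - h <= 1 - p ->
  `|g - h * p^-1| <= 1 - p.
Proof.
move=> /andP[p0 p1] h0 hg hp ghp.
have hpV : h * p^-1 * p = h by rewrite mulfVK ?gt_eqF.
have hV0 : 0 <= h * p^-1 by rewrite mulr_ge0// invr_ge0 ltW.
have hV1 : h * p^-1 <= 1 by rewrite ler_pdivrMr// mul1r.
by rewrite ler_norml; apply/andP; split; nra.
Qed.

Theorem theorem2p13 (R : realType) (K : topologicalFieldType)
  (K_local : local_field R K) (v : normalized_valuation R K)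
  (lambda : normalized_haar v) (n k : nat)
  (k_gt0 : (0 < k)%N) (k_le_n : (k <= n)%N) :
  let q : R := (resq v)%:R in
  tv_dist (distribution (sigma lambda n) (tprefix k_le_n))
          (gamma_pow lambda k)
  = (q ^- n * (1 - q ^- k) / (1 - q ^- n))%:E.
Proof.
move=> q.
have n_gt0 : (0 < n)%N := leq_trans k_gt0 k_le_n.
have q1 : 1 < q := resq_gt1 v; have q0 : 0 < q by exact: lt_trans q1.
set M := cube (max_ideal v) k.
have mM : measurable M by apply: measurable_cube; exact: measurable_max_ideal.
have gM : gamma_pow lambda k M = (q ^- k)%:E by exact: gamma_pow_cube_max_ideal.
have p0 : 0 < q ^- k by rewrite invr_gt0 exprn_gt0.
have p1 : q ^- k <= 1 by rewrite invf_le1 ?exprn_gt0// exprn_ege1// ltW.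
have s0 : 0 <= q ^- n / (1 - q ^- n).
  rewrite divr_ge0//; first by rewrite invr_ge0 exprn_ge0// ltW.
  by rewrite subr_ge0 invf_le1 ?exprn_gt0// exprn_ege1// ltW.
rewrite mulrAC /tv_dist; apply/eqP; rewrite eq_le; apply/andP; split.
  apply: ge_ereal_sup => _ [B mB <-].
  rewrite projected_sigma_bias// abse_EFin lee_fin normrM (ger0_norm s0).
  have mBM : measurable (B `&` M) by exact: measurableI.
  apply: ler_wpM2l => //; apply: conditioning_bias_le.
  - by rewrite p0 p1.
  - by apply: fine_ge0.
  - rewrite fine_le ?fin_num_measure//; apply: le_measure; rewrite ?inE//.
  - rewrite -lee_fin fineK ?fin_num_measure// -gM.
    by apply: le_measure; rewrite ?inE//.
  - rewrite -lee_fin !EFinB !fineK ?fin_num_measure//.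
    rewrite -measureD//; last by rewrite ltey_eq fin_num_measure.
    rewrite -gM -probability_setC//.
    apply: le_measure; rewrite ?inE//.
      exact: measurableD.
    exact: measurableC.
(* The bound is attained at the cube of the maximal ideal. *)
apply: ereal_sup_ubound; exists M => //.
rewrite projected_sigma_bias// setIid gM /= mulfV ?gt_eqF//.
by rewrite normrM (ger0_norm s0) distrC ger0_norm// subr_ge0.
Qed.
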